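(* Let $X$ be the classical risk process, let $x\in\mathbb{R}$ be fixed, and let $L_t(x)$, $\varphi_{x,n}$, $\varphi_{x,n}'$ and $L^n_t(x)$ ($n\in\mathbb{N}$) be as defined in the context. Then: (a) With probability 1, for all $n\in\mathbb{N}$ and all $t>0$, $$L_t^n(x)=\int_0^t\varphi_{x,n}'(X_{s-})\,ds+\frac1c\sum_{0<s\le t}\varphi_{x,n}'(X_{s-})\,\Delta X_s .$$ (b) With probability 1, $\lim_{n\to\infty}L^n_t(x)=L_t(x)$ for all $t>0$.
   Context: The classical risk process is $X=\{X_t,t\ge 0\}$, $X_t=x_0+ct-\sum_{k=1}^{N_t}R_k$, where $x_0\ge 0$ and $c>0$ are constants, $N=\{N_t,t\ge0\}$ is a homogeneous Poisson process with rate $\alpha>0$, and $\{R_k,k\in\mathbb{N}\}$ is a sequence of i.i.d. non-negative random variables independent of $N$. It is assumed that $R_1$ has finite mean and is an absolutely continuous random variable (its law has a density with respect to Lebesgue measure). $X$ has càdlàg paths, $X_0=x_0$, $X_{s-}$ denotes the left limit at $s>0$, and $\Delta X_s=X_s-X_{s-}$. The random field $L$ is defined for $t\ge 0$ and $x\in\mathbb{R}$ by $$L_t(x)=\frac1c\Big(\tfrac12 1_{\{x\}}(X_t)+1_{(x,\infty)}(X_t)-\tfrac12 1_{\{x\}}(x_0)-1_{(x,\infty)}(x_0)-\sum_{0<s\le t}\{1_{(x,\infty)}(X_s)-1_{(x,\infty)}(X_{s-})\}\Big).$$ For $n\in\mathbb{N}$ (positive integers), $\varphi_{x,n}:\mathbb{R}\to\mathbb{R}$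 is given by $\varphi_{x,n}(y)=0$ for $y<x-1/n$, $\varphi_{x,n}(y)=(n(y-x)+1)/2$ for $x-1/n\le y\le x+1/n$, and $\varphi_{x,n}(y)=1$ for $y>x+1/n$. Its derivative is $\varphi_{x,n}'(y)=n/2$ for $x-1/n<y<x+1/n$ and $\varphi_{x,n}'(y)=0$ for $y<x-1/n$ or $y>x+1/n$; at the two points $y=x\pm1/n$ set $\varphi_{x,n}'(y)=0$ by convention. Define $$L^n_t(x)=\frac1c\Big(\varphi_{x,n}(X_t)-\varphi_{x,n}(X_0)-\sum_{0<s\le t}\{\varphi_{x,n}(X_s)-\varphi_{x,n}(X_{s-})-\varphi_{x,n}'(X_{s-})\Delta X_s\}\Big).$$ Almost surely $N_t<\infty$ for all $t>0$, so in all these sums only finitely many summands are non-zero. *)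

(* Defs.v *)
From HB Require Import structures.
From mathcomp Require Export all_boot all_order all_algebra.
From mathcomp Require Export all_classical all_reals all_analysis.

Set Implicit Arguments.
Unset Strict Implicit.
Unset Printing Implicit Defensive.

Import Order.TTheory GRing.Theory Num.Theory.
Import numFieldNormedType.Exports.

Local Open Scope classical_set_scope.
Local Open Scope ring_scope.

Section Independence.
Context {d d' d'' : measure_display} {T : measurableType d}
  {T1 : measurableType d'} {T2 : measurableType d''} {R : realType}.
Variable P : probability T R.

(* Mutual independence: product rule over every finite subfamily (J is a
   duplicate-free list of indices). *)
Definition mutually_independent (I : eqType) (X : I -> T -> T1) : Prop :=
  forall (J : seq I) (A : I -> set T1), uniq J ->
    (forall i, measurable (A i)) ->
    P (\bigcap_(i in [set` J]) (X i @^-1` A i)) =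
    (\prod_(i <- J) P (X i @^-1` A i))%E.

Definition process_sigma_algebra {dT : measure_display} {T' : measurableType dT}
    (I : Type) (D : set I) (X : I -> T -> T') : set (set T) :=
  <<s \bigcup_(i in D) preimage_set_system setT (X i) measurable >>.

Definition independent_processes (I1 I2 : Type) (D1 : set I1) (D2 : set I2)
    (X1 : I1 -> T -> T1) (X2 : I2 -> T -> T2) : Prop :=
  forall A B : set T,
    process_sigma_algebra D1 X1 A -> process_sigma_algebra D2 X2 B ->
    P (A `&` B) = (P A * P B)%E.

End Independence.

Section Laws.
Context {d : measure_display} {T : measurableType d} {R : realType}.
Variable P : probability T R.

Definition iid (Y : nat -> {RV P >-> R}) : Prop :=
  mutually_independent P (fun k => Y k : T -> R) /\
  forall k (A : set R), measurable A ->
    distribution P (Y k) A = distribution P (Y 0%N) A.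

Definition has_density (Z : {RV P >-> R}) : Prop :=
  exists f : R -> R,
    [/\ measurable_fun setT f,
        forall y, 0 <= f y &
        forall A : set R, measurable A ->
          distribution P Z A = (\int[lebesgue_measure]_(y in A) (f y)%:E)%E].

(* Processes are indexed by all of R; only times t >= 0 are meaningful. The
   path properties are required almost surely. Truncated subtraction on nat
   gives the increment N_t - N_s because the paths are nondecreasing.
   Independence of increments is stated along infinite nondecreasing sequences
   of times: finite subdivisions are the eventually constant ones, and mutual
   independence only involves finite subfamilies. *)
Record is_poisson_process (alpha : R) (N : R -> {RV P >-> nat}) : Prop := {
  poisson_start : {ae P, forall w, N 0 w = 0%N} ;
  poisson_paths : {ae P, forall w,
    (forall s t, 0 <= s -> s <= t -> (N s w <= N t w)%N) /\
    (forall t, 0 <= t -> N u w @[u --> t^'+] --> N t w)} ;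
  poisson_increments : forall s t, 0 <= s -> s < t -> forall k : nat,
    P [set w | (N t w - N s w)%N = k] =
    (poisson_pmf (alpha * (t - s)) k)%:E ;
  poisson_independent_increments : forall t : nat -> R,
    0 <= t 0%N -> (forall i, t i <= t i.+1) ->
    mutually_independent P
      (fun (i : nat) (w : T) => (N (t i.+1) w - N (t i) w)%N) }.

(* The k-th claim, k = 1, 2, and so on, is Y k.-1, so that Y 0 is the first. *)
Definition risk_process (x0 c : R) (N : R -> {RV P >-> nat})
    (Y : nat -> {RV P >-> R}) (t : R) (w : T) : R :=
  x0 + c * t - \sum_(k < N t w) Y k w.

End Laws.

(* Functionals of a single path X : R -> R. The sums over ]0, t] are the
   library's finitely supported sums (value 0 when the support is infinite). *)
Section PathFunctionals.
Context {R : realType}.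
Implicit Types (c x y s t : R) (n : nat) (X : R -> R).

Definition left_lim X s : R := lim (X u @[u --> s^'-]).

Definition jump X s : R := X s - left_lim X s.

Definition local_field c (x0 : R) x X t : R :=
  c^-1 * (2^-1 * \1_[set x] (X t) + \1_(`]x, +oo[) (X t)
          - 2^-1 * \1_[set x] x0 - \1_(`]x, +oo[) x0
          - \sum_(s \in `]0, t])
              (\1_(`]x, +oo[) (X s) - \1_(`]x, +oo[) (left_lim X s) : R)).

Definition phi x n y : R :=
  if y < x - n%:R^-1 then 0
  else if y <= x + n%:R^-1 then (n%:R * (y - x) + 1) / 2
  else 1.

(* Derivative in y of phi x n, with value 0 at the two corners x - 1/n, x + 1/n. *)
Definition dphi x n y : R :=
  if x - n%:R^-1 < y < x + n%:R^-1 then n%:R / 2 else 0.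

Definition approx_local_field c x n X t : R :=
  c^-1 * (phi x n (X t) - phi x n (X 0)
          - \sum_(s \in `]0, t])
              (phi x n (X s) - phi x n (left_lim X s)
               - dphi x n (left_lim X s) * jump X s)).

End PathFunctionals.

(* Main.v *)
Require Import Defs.
From mathcomp Require Import all_boot all_order all_algebra.
From mathcomp Require Import all_classical all_reals all_analysis.
From mathcomp Require Import measurable_realfun.
From mathcomp Require Import ring lra.

Set Implicit Arguments.
Unset Strict Implicit.
Unset Printing Implicit Defensive.

Import Order.TTheory GRing.Theory Num.Theory.
Import numFieldNormedType.Exports.

Local Open Scope classical_set_scope.
Local Open Scope ring_scope.

(** A path is made of finitely many lines of slope c > 0 on each ]0, t], and
    everything happens path by path, except for one almost sure property needed
    in (b).

    For (a), phi x n is a primitive of dphi x n along every line of slope c, in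
    the sense that the increment of phi x n (b + c s) over ]u, v] is c times the
    integral of dphi x n (b + c s). Summing this over the pieces of the path
    telescopes, and each claim contributes the increment of phi x n between
    X_{s-} and X_s:
      c * int_]0,t] dphi x n (X_{s-}) ds
        = phi x n (X_t) - phi x n (X_0) - sum (phi x n (X_s) - phi x n (X_{s-})).
    This is lemma [occupation_formula_affine_pieces]; (a) is a rearrangement of
    it ([approx_local_fieldE]).

    For (b), phi x n tends pointwise to 1_]x,oo[ + 1_{x}/2, and the sums have
    finitely many terms, so limits can be taken term by term. The term of a
    claim at time s converges to the right value as soon as neither X_{s-} nor
    X_s equals x: then the half weights at x vanish, and so does dphi x n (X_{s-})
    for large n, whereas at X_{s-} = x it would be n / 2
    ([approx_local_field_cvg]).

    It remains to see that almost surely no claim starts or ends at level x. If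
    one does, then c s = x - x0 + Y_0 + ... + Y_{j-1} for some j. The right-hand
    side is a random variable independent of the Poisson process, and a Poisson
    process almost surely does not jump at an independent time tau
    ([no_jump_at_independent_time]): cut time into cells of length h; in the cell
    containing tau there is a jump with probability at most alpha h by
    independence, and h is arbitrary. *)

(** * Paths that are piecewise lines of slope c *)
Section Path.
Context {R : realType}.
Implicit Types (X f g : R -> R) (Q : R -> R -> Prop).

(** Continuous induction: the supremum of the v with [Q 0 v] is reached by the
    hypothesis on the left, and could be exceeded, if it were below t, by the
    hypothesis on the right. It spares the enumeration of the jump times of a
    path, and yields their finiteness as well. *)
Lemma chain_of_local Q :
  (forall u v w, u <= v -> v <= w -> Q u v -> Q v w -> Q u w) ->
  (forall s, 0 < s -> exists2 a, 0 <= a < s & forall u, a < u < s -> Q u s) ->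
  (forall s, 0 <= s -> exists2 e, s < e & forall u, s <= u < e -> Q s u) ->
  forall t, 0 <= t -> Q 0 t.
Proof.
move=> Qtrans Qleft Qright t t0.
have Q00 : Q 0 0.
  by have [e e0 Qe] := Qright 0 (lexx _); apply: Qe; rewrite lexx e0.
pose S := [set v | 0 <= v <= t /\ Q 0 v].
have S0 : S 0 by split=> //; rewrite lexx.
have Sub : ubound S t by move=> v [/andP[]].
have hS : has_sup S by split; [exists 0 | exists t].
set m := sup S.
have m0 : 0 <= m by apply: sup_upper_bound.
have mt : m <= t by apply: ge_sup => //; exists 0.
have Qm : Q 0 m.
  have [->//|mn0] := eqVneq m 0.
  have {}m0 : 0 < m by rewrite lt_neqAle eq_sym mn0.
  have [a /andP[a0 am] Qa] := Qleft m m0.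
  have [v [/andP[v0 vt] Qv] av] : exists2 v, S v & a < v.
    have /(sup_adherent)/(_ hS) : 0 < m - a by rewrite subr_gt0.
    by rewrite -/m opprB addrC subrK.
  have vm : v <= m by apply: sup_upper_bound => //; split; rewrite ?v0.
  have [<-//|vnm] := eqVneq v m.
  apply: (Qtrans _ v) => //; apply: Qa; rewrite av /=.
  by rewrite lt_neqAle vnm.
have [<-//|mnt] := eqVneq m t.
have {}mt : m < t by rewrite lt_neqAle mnt.
have [e me Qe] := Qright m m0.
pose w := Num.min t ((m + e) / 2).
have mw : m < w by rewrite lt_min mt midf_lt.
have : S w.
  split; first by rewrite ge_min lexx andbT (le_trans m0 (ltW mw)).
  apply: (Qtrans _ m) => //; first exact: ltW.
  by apply: Qe; rewrite (ltW mw) gt_min midf_lt// orbT.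
by move=> /(sup_upper_bound hS); rewrite leNgt mw.
Qed.

(** The pieces are closed on the left and open on the right, as the paths are
    right-continuous. *)
Definition affine_pieces c X : Prop :=
  (forall s, 0 < s ->
    exists2 a, 0 <= a < s & exists b, forall u, a < u < s -> X u = b + c * u) /\
  (forall s, 0 <= s ->
    exists2 e, s < e & exists b, forall u, s <= u < e -> X u = b + c * u).

Lemma left_lim_affine c b X a s : a < s ->
  (forall u, a < u < s -> X u = b + c * u) -> left_lim X s = b + c * s.
Proof.
move=> lt_as Xaff; apply: cvg_lim => //.
apply: (@cvg_trans _ ((fun u => b + c * u) @ s^'-)).
  apply: near_eq_cvg; near=> u; apply/esym/Xaff; apply/andP; split; near: u.
    exact: nbhs_left_gt.
  exact: nbhs_left_lt.
apply: cvg_at_left_filter; apply: cvgD; first exact: cvg_cst.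
by apply: cvgM; [exact: cvg_cst|exact: cvg_id].
Unshelve. all: by end_near. Qed.

Definition jump_times X u v : set R :=
  `]u, v] `&` [set s | left_lim X s != X s].

(** Finiteness and integrability are part of the formula because they are what
    makes it additive in the interval: the finitely supported sum is zero, by
    convention, on an infinite support. *)
Definition occupation_formula c X f g u v : Prop :=
  [/\ finite_set (jump_times X u v),
      lebesgue_measure.-integrable `]u, v] (EFin \o (fun s => g (left_lim X s))) &
      c * \int[lebesgue_measure]_(s in `]u, v]) g (left_lim X s) =
        f (X v) - f (X u)
        - \sum_(s \in jump_times X u v) (f (X s) - f (left_lim X s))].

(** An integral form of [f' = g] along the pieces of a path, which tolerates the
    two corners of [phi]. *)
Definition primitive_along_lines c f g : Prop :=
  forall b u v, u <= v ->
    lebesgue_measure.-integrable `]u, v] (EFin \o (fun s => g (b + c * s))) /\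
    c * \int[lebesgue_measure]_(s in `]u, v]) g (b + c * s) =
      f (b + c * v) - f (b + c * u).

Lemma itv_oc_split (u v w : R) : u <= v -> v <= w ->
  `]u, w]%classic = `]u, v] `|` `]v, w].
Proof. by move=> uv vw; rewrite -itv_bndbnd_setU// bnd_simp. Qed.

Lemma itv_oc_disj (u v w : R) : `]u, v] `&` `]v, w] = set0.
Proof.
rewrite -subset0 => s [] /=; rewrite !in_itv /= => /andP[_ sv] /andP[vs _].
by rewrite ltNge sv in vs.
Qed.

Lemma integrable_setU d (T : measurableType d) (mu : {measure set T -> \bar R})
    (A B : set T) (h : T -> \bar R) :
  measurable A -> measurable B -> [disjoint A & B] ->
  mu.-integrable A h -> mu.-integrable B h -> mu.-integrable (A `|` B) h.
Proof.
move=> mA mB AB /integrableP[mhA hA] /integrableP[mhB hB].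
have mh : measurable_fun (A `|` B) h by apply/measurable_funU.
apply/integrableP; split=> //.
rewrite ge0_integral_setU//; first exact: lte_add_pinfty.
exact: measurableT_comp.
Qed.

Lemma occupation_formula_trans c X f g u v w : u <= v -> v <= w ->
  occupation_formula c X f g u v -> occupation_formula c X f g v w ->
  occupation_formula c X f g u w.
Proof.
move=> uv vw [fin1 int1 eq1] [fin2 int2 eq2].
have JU : jump_times X u w = jump_times X u v `|` jump_times X v w.
  by rewrite /jump_times (itv_oc_split uv vw) setIUl.
have Jdisj : jump_times X u v `&` jump_times X v w `<=` set0.
  rewrite /jump_times setIACA itv_oc_disj set0I; exact: subset_refl.
have intU : lebesgue_measure.-integrable (`]u, v] `|` `]v, w])
    (EFin \o (fun s => g (left_lim X s))).
  by apply: integrable_setU => //; rewrite disj_set2E itv_oc_disj.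
split.
- by rewrite JU finite_setU.
- by rewrite (itv_oc_split uv vw).
- rewrite JU fsbigU0// (itv_oc_split uv vw) Rintegral_setU//; last first.
    by rewrite disj_set2E itv_oc_disj.
  rewrite mulrDr eq1 eq2 /=; ring.
Qed.

(** A jump at the endpoint v is allowed; the left limits on ]u, v] do not see
    it, and it is then the only term of the sum. *)
Lemma occupation_formula_affine c b X f g u v :
  primitive_along_lines c f g -> u <= v ->
  (forall s, u <= s < v -> X s = b + c * s) -> occupation_formula c X f g u v.
Proof.
move=> fg uv Xaff.
have llX s : s \in `]u, v] -> left_lim X s = b + c * s.
  rewrite in_itv /= => /andP[us sv]; apply: (left_lim_affine us) => r /andP[ur rs].
  by apply: Xaff; rewrite (ltW ur) (lt_le_trans rs sv).
have Jv : jump_times X u v `<=` [set v].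
  move=> s [] us /= Xs; move: us; rewrite /= in_itv /= => /andP[us sv].
  apply/eqP; rewrite eq_le sv /= leNgt; apply: contra Xs => sv'.
  by rewrite llX ?in_itv /= ?us// Xaff// (ltW us).
have [int_g eq_g] := fg b u v uv.
have eq_int : {in `]u, v]%classic, (fun s => g (b + c * s)) =1 (fun s => g (left_lim X s))}.
  by move=> s; rewrite inE => /llX ->.
split.
- by apply: sub_finite_set Jv _; exact: finite_set1.
- apply: eq_integrable int_g => // s su; by rewrite /= eq_int.
- have -> : \int[lebesgue_measure]_(s in `]u, v]) g (left_lim X s) =
            \int[lebesgue_measure]_(s in `]u, v]) g (b + c * s).
    by apply: eq_Rintegral => s su; rewrite -eq_int.
  rewrite eq_g.
  have [uv_eq|unv] := eqVneq u v.
    rewrite -uv_eq !subrr (_ : jump_times X u u = set0) ?fsbig_set0 ?subr0//.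
    by rewrite /jump_times set_itvoc0 ?set0I.
  have {uv unv}uv : u < v by rewrite lt_neqAle unv.
  rewrite (fsbig_widen _ [set v])//; last first.
    move=> s [] /= -> nJ; apply/eqP; rewrite subr_eq0; apply/eqP; congr f.
    apply/esym/eqP; apply: contra_notT nJ => Xv.
    by split=> //=; rewrite in_itv /= uv lexx.
  rewrite fsbig_set1 llX ?in_itv /= ?uv ?lexx// (Xaff u) ?lexx ?uv//.
  ring.
Qed.

Lemma occupation_formula_affine_pieces c X f g t :
  primitive_along_lines c f g -> affine_pieces c X -> 0 <= t ->
  occupation_formula c X f g 0 t.
Proof.
move=> fg [Xleft Xright]; apply: chain_of_local => [u v w|s s0|s s0].
- exact: occupation_formula_trans.
- have [a a_s [b Xb]] := Xleft s s0; exists a => // u /andP[au us].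
  apply: (@occupation_formula_affine _ b) => //; first exact: ltW.
  by move=> r /andP[ur rs]; apply: Xb; rewrite (lt_le_trans au ur).
- have [e se [b Xb]] := Xright s s0; exists e => // u /andP[su ue].
  apply: (@occupation_formula_affine _ b) => // r /andP[sr ru].
  by apply: Xb; rewrite sr (lt_trans ru ue).
Qed.

End Path.

(** * The approximations phi x n and their limit *)

Section Approximation.
Context {R : realType}.
Implicit Types (x y c t : R) (X : R -> R) (n : nat).

(** Along the line, [dphi] is n / 2 times the indicator of the time interval
    ]p, q[ during which the line stays within 1 / n of x, and [phi] is an affine
    function of time clamped to [p, q]. *)
Lemma primitive_along_lines_phi c x n : 0 < c -> (0 < n)%N ->
  primitive_along_lines c (phi x n) (dphi x n).
Proof.
move=> c0 n0 b u v uv.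
have nR0 : 0 < n%:R :> R by rewrite ltr0n.
have dphiE : (fun s => dphi x n (b + c * s)) =
    (fun s => n%:R / 2 * \1_`](x - n%:R^-1 - b) / c, (x + n%:R^-1 - b) / c[ s).
  apply/funext => s; rewrite /dphi indicE mem_setE in_itv /=.
  rewrite ltr_pdivrMr// ltr_pdivlMr// [_ - b < _]ltrBlDl [_ < _ - b]ltrBrDl [s * c]mulrC.
  by case: ifP => _; rewrite ?mulr1 ?mulr0.
set p := (x - n%:R^-1 - b) / c in dphiE *.
set q := (x + n%:R^-1 - b) / c in dphiE *.
have pq : p < q.
  rewrite ltr_pM2r ?invr_gt0// ltrD2r ltrD2l.
  by rewrite (@lt_trans _ _ 0) ?oppr_lt0 ?invr_gt0.
have int1 : lebesgue_measure.-integrable `]u, v] (EFin \o \1_`]p, q[).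
  by apply: (integrableS measurableT _ _ (integrable_indic_itv p q false true)).
rewrite dphiE; split.
  by apply: eq_integrable (integrableZl _ (n%:R / 2) int1).
rewrite RintegralZl//.
have phiE s : phi x n (b + c * s) =
    c * (n%:R / 2) * (Num.max p (Num.min q s) - p).
  have cnpq : c * (n%:R / 2) * (q - p) = 1.
    by rewrite /p /q; field; rewrite (gt_eqF c0) (gt_eqF nR0).
  have sp : (b + c * s < x - n%:R^-1) = (s < p).
    by rewrite ltr_pdivlMr// [_ < _ - b]ltrBrDl [s * c]mulrC.
  have sq : (b + c * s <= x + n%:R^-1) = (s <= q).
    by rewrite ler_pdivlMr// [_ <= _ - b]lerBrDl [s * c]mulrC.
  rewrite /phi sp sq; case: ltP => [lt_sp|ps].
    by rewrite max_l ?subrr ?mulr0// ge_min (ltW lt_sp) orbT.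
  case: (leP s q) => [sq'|qs].
    by rewrite max_r// /p; field; rewrite (gt_eqF c0) (gt_eqF nR0).
  by rewrite max_r ?cnpq// ltW.
rewrite !phiE -mulrBr mulrA; congr (_ * _).
rewrite /Rintegral integral_indic//.
rewrite -set_itvI; set i := (_ `&` _)%O.
transitivity (fine (if (i.1 < i.2)%E then ((i.2 : \bar R) - i.1)%E else 0%E)).
  by congr fine; exact: lebesgue_measure_itv.
rewrite /= joinEtotal meetEtotal lte_fin.
(* Hides the quotients in p and q, which are mere constants for the comparison. *)
clear i int1 phiE dphiE; clearbody p q.
by case: ltP => /=; case: (leP q v) => ?; case: (leP q u) => ?;
  case: (leP p u) => ?; case: (leP p v) => ?; case: (leP p q) => ? ?; lra.
Qed.

Lemma near_invn_lt (e : R) : 0 < e -> \forall n \near \oo, n%:R^-1 < e.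
Proof.
move=> e0; near=> n.
rewrite invf_plt ?posrE ?ltr0n//; near: n; first exact: nbhs_infty_gtr.
exact: nbhs_infty_gt.
Unshelve. all: by end_near. Qed.

Lemma phi_cvg x y : phi x n y @[n --> \oo] -->
  (2^-1 * \1_[set x] y + \1_(`]x, +oo[) y : R).
Proof.
apply: cvg_near_cst; rewrite !indicE mem_setE in_itv /= andbT.
have [yx|xy|->] := ltgtP y x.
- have /near_invn_lt : 0 < x - y by rewrite subr_gt0.
  apply: filterS => n nxy; rewrite /phi ifT; last by lra.
  by rewrite memNset /= ?mulr0 ?addr0// => yx'; move: yx; rewrite yx' ltxx.
- have /near_invn_lt : 0 < y - x by rewrite subr_gt0.
  apply: filterS => n nxy; have n0 : 0 <= n%:R^-1 :> R by rewrite invr_ge0.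
  rewrite /phi ifF ?ifF; [|lra|lra].
  by rewrite memNset /= ?mulr0 ?add0r// => yx'; move: xy; rewrite yx' ltxx.
- apply: nearW => n; have n0 : 0 <= n%:R^-1 :> R by rewrite invr_ge0.
  rewrite mem_set// addr0 mulr1 /phi ifF ?ifT; [|lra|lra].
  by rewrite subrr mulr0 add0r mul1r.
Qed.

Lemma dphi_cvg0 x y : y != x -> dphi x n y @[n --> \oo] --> (0 : R).
Proof.
move=> yx; apply: cvg_near_cst.
have /near_invn_lt : 0 < `|y - x| by rewrite normr_gt0 subr_eq0.
apply: filterS => n nyx; rewrite /dphi ifF//; apply: contraTF nyx.
by move=> /andP[? ?]; rewrite -leNgt ler_norml; apply/andP; split; lra.
Qed.

(** The set of jump times being finite for the paths considered here, sums over
    it can be split and passed to the limit. *)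
Lemma fsum_jump_times X t (h : R -> R) :
  (forall s, X s = left_lim X s -> h s = 0) ->
  \sum_(s \in `]0, t]) h s = \sum_(s \in jump_times X 0 t) h s.
Proof.
move=> h0; apply/esym/fsbig_widen; first by move=> s [].
move=> s [st nJ]; apply: h0; apply/esym/eqP.
by apply: contra_notT nJ => Xs; split.
Qed.

Lemma cvg_sum_jumps X t (h : nat -> R -> R) (l : R -> R) :
  finite_set (jump_times X 0 t) ->
  (forall n s, X s = left_lim X s -> h n s = 0) ->
  (forall s, X s = left_lim X s -> l s = 0) ->
  (forall s, 0 < s -> left_lim X s != X s -> h n s @[n --> \oo] --> l s) ->
  \sum_(s \in `]0, t]) h n s @[n --> \oo] --> \sum_(s \in `]0, t]) l s.
Proof.
move=> fin h0 l0 hl; rewrite (fsum_jump_times _ l0) fsbig_finite//= big_seq.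
have -> : (fun n => \sum_(s \in `]0, t]) h n s) =
    fun n => \sum_(s <- finmap.enum_fset (fset_set (jump_times X 0 t)) |
                    s \in finmap.enum_fset (fset_set (jump_times X 0 t))) h n s.
  by apply/funext => n; rewrite (fsum_jump_times _ (h0 n)) fsbig_finite//= big_seq.
apply: cvg_big => [|s]; first exact: add_continuous.
rewrite in_fset_set// inE => -[/=]; rewrite in_itv /= => /andP[s0 _].
exact: hl.
Qed.

Lemma approx_local_fieldE c x n X t : 0 < c -> (0 < n)%N ->
  affine_pieces c X -> 0 <= t ->
  approx_local_field c x n X t =
    \int[lebesgue_measure]_(s in `]0, t]) dphi x n (left_lim X s)
    + c^-1 * \sum_(s \in `]0, t]) (dphi x n (left_lim X s) * jump X s).
Proof.
move=> c0 n0 Xc t0.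
have [fin _ occ] := occupation_formula_affine_pieces
  (primitive_along_lines_phi x c0 n0) Xc t0.
have c_neq0 : c != 0 by rewrite gt_eqF.
apply: (mulfI c_neq0); rewrite mulrDr occ /approx_local_field.
rewrite !(mulVKf c_neq0).
rewrite !(@fsum_jump_times X)/jump; last 2 first.
- by move=> s ->; rewrite !(subrr, mulr0).
- by move=> s ->; rewrite !(subrr, mulr0).
rewrite !fsbig_finite//= big_split /= sumrN; ring.
Qed.

(** The condition on the jumps is essential: a jump from the level x contributes
    a term of order n, and for a jump ending at x the value 1 / 2 of [phi x n x]
    differs from the indicator of ]x, +oo[ at x. *)
Lemma approx_local_field_cvg c x X t : 0 < c -> affine_pieces c X -> 0 <= t ->
  (forall s, 0 < s -> left_lim X s != X s -> left_lim X s != x /\ X s != x) ->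
  approx_local_field c x n X t @[n --> \oo] --> local_field c (X 0) x X t.
Proof.
move=> c0 Xc t0 Xx.
have [fin _ _] := occupation_formula_affine_pieces
  (primitive_along_lines_phi x c0 (ltn0Sn 0)) Xc t0.
rewrite /approx_local_field /local_field.
apply: cvgM; first exact: cvg_cst.
rewrite (_ : 2^-1 * _ + _ - _ - _ = (2^-1 * \1_[set x] (X t) + \1_(`]x, +oo[) (X t)) -
  (2^-1 * \1_[set x] (X 0) + \1_(`]x, +oo[) (X 0))); last by ring.
apply: cvgB; first by apply: cvgB; exact: phi_cvg.
apply: (cvg_sum_jumps fin) => [n s|s|s s0 Xs].
- by rewrite /jump => ->; rewrite !(subrr, mulr0).
- by move=> ->; rewrite subrr.
have [llx Xsx] := Xx s s0 Xs.
have XsE y : y != x -> \1_(`]x, +oo[) y = 2^-1 * \1_[set x] y + \1_(`]x, +oo[) y :> R.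
  by move=> /eqP yx; rewrite [\1_[set x] y]indicE memNset// mulr0 add0r.
rewrite (XsE _ llx) (XsE _ Xsx) -[X in _ --> X]subr0.
apply: cvgB; first by apply: cvgB; exact: phi_cvg.
rewrite -[X in _ --> X](mul0r (jump X s)).
by apply: cvgM; [exact: dphi_cvg0|exact: cvg_cst].
Qed.

End Approximation.

(** * Paths driven by a counting function *)

Section RiskPath.
Context {R : realType}.
Context (x0 c : R) (k : R -> nat) (S : nat -> R).
Context (k_mono : forall s t, 0 <= s -> s <= t -> (k s <= k t)%N).
Context (k_rcont : forall t, 0 <= t -> k u @[u --> t^'+] --> k t).

Let X t := x0 + c * t - S (k t).

(** The values of k on [0, s[ are bounded by [k s]; k is constant from the moment
    it reaches the largest of them. *)
Lemma count_left_constant s : 0 < s ->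
  exists2 a, 0 <= a < s & forall u, a < u < s -> k u = k a.
Proof.
move=> s0.
pose attained j := `[< exists2 a, 0 <= a < s & k a = j >].
have attained_ex : exists j, attained j.
  by exists (k 0); apply/asboolP; exists 0; rewrite ?lexx.
have attained_le j : attained j -> (j <= k s)%N.
  by move=> /asboolP[a /andP[a0 as_] <-]; apply: k_mono => //; exact: ltW.
case: (ex_maxnP attained_ex attained_le) => j /asboolP[a /andP[a0 lt_as] kaj] jmax.
exists a; first by rewrite a0.
move=> u /andP[au us]; apply/eqP; rewrite eqn_leq (k_mono a0 (ltW au)) andbT kaj.
by apply: jmax; apply/asboolP; exists u => //; rewrite us (le_trans a0 (ltW au)).
Qed.

Lemma count_right_constant s : 0 <= s ->
  exists2 e, s < e & forall u, s <= u < e -> k u = k s.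
Proof.
move=> s0.
have : \forall u \near s^'+, k u = k s.
  by move/discrete_cvg: (k_rcont s0).
rewrite /at_right near_withinE => /nbhs_ballP[e /= e0 ke].
exists (s + e); first by rewrite ltrDl.
move=> u /andP[]; rewrite le_eqVlt => /predU1P[->//|su] use.
by apply: ke => //; rewrite -ball_normE /= distrC ger0_norm ?subr_ge0 ?ltW//; lra.
Qed.

Lemma risk_path_affine_pieces : affine_pieces c X.
Proof.
split=> s s0.
- have [a as_ ka] := count_left_constant s0; exists a => //.
  by exists (x0 - S (k a)) => u au; rewrite /X (ka u au); ring.
- have [e se ke] := count_right_constant s0; exists e => //.
  by exists (x0 - S (k s)) => u su; rewrite /X (ke u su); ring.
Qed.

(** A jump of the path forces a jump of k, since k would otherwise be constant
    on a neighbourhood to the left of s, up to s included. Simultaneous claims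
    are covered, as j need not be [(k s).-1]. *)
Lemma risk_path_jump s : 0 < s -> left_lim X s != X s ->
  (forall r, 0 <= r < s -> (k r < k s)%N) /\
  exists j, left_lim X s = x0 + c * s - S j.
Proof.
move=> s0; have [a /andP[a0 lt_as] ka] := count_left_constant s0.
have -> : left_lim X s = x0 - S (k a) + c * s.
  by apply: (left_lim_affine lt_as) => u au; rewrite /X (ka u au); ring.
move=> Xs; split; last by exists (k a); ring.
move=> r /andP[r0 rs]; rewrite ltnNge; apply: contra Xs => ksr.
have kr u : r <= u < s -> k u = k s.
  move=> /andP[ru us]; apply/eqP; rewrite eqn_leq (k_mono (le_trans r0 ru) (ltW us)).
  exact: leq_trans ksr (k_mono r0 ru).
have -> : k a = k s; last by apply/eqP; rewrite /X; ring.
pose u := (Num.max a r + s) / 2.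
have mu : Num.max a r < s by rewrite gt_max lt_as rs.
have [au us] : Num.max a r < u /\ u < s by rewrite !midf_lt.
move: au; rewrite gt_max => /andP[au ru].
by rewrite -(ka u) ?au// kr// us (ltW ru).
Qed.

End RiskPath.

(** * A Poisson process does not jump at an independent time *)

Section NoCommonJump.
Context d (T : measurableType d) (R : realType) (P : probability T R).
Implicit Types (alpha : R) (N : R -> {RV P >-> nat}) (tau : T -> R).

(** Measurability of events of a process can thus be proved, by the usual
    closure properties, within the sigma-algebra that it generates. *)
Lemma process_measurable dT (T' : measurableType dT) (I : Type) (D : set I)
    (X : I -> T -> T') (i : I) : D i ->
  measurable_fun (setT : set (g_sigma_algebraType
    (\bigcup_(i in D) preimage_set_system setT (X i) measurable))) (X i).
Proof.
move=> Di _ A mA; apply: sub_gen_smallest; exists i => //.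
by exists A.
Qed.

(** The probability is [1 - expR (- lambda)] with [lambda = alpha * (b - a)], and
    [1 - lambda <= expR (- lambda)]. *)
Lemma poisson_jump_prob alpha N a b : is_poisson_process alpha N -> 0 < alpha ->
  0 <= a -> a < b ->
  (P [set w | (N a w < N b w)%N] <= (alpha * (b - a))%:E)%E.
Proof.
move=> hN alpha0 a0 ab.
have m0 : measurable [set w | (N b w - N a w)%N = 0%N].
  rewrite (_ : mkset _ = (fun w => (N b w <= N a w)%N) @^-1` [set true]).
    by rewrite -[X in measurable X]setTI; apply: measurable_fun_leq.
  by apply/seteqP; split=> w /= /eqP; rewrite ?subn_eq0// => /eqP/eqP; rewrite subn_eq0.
have -> : [set w | (N a w < N b w)%N] = ~` [set w | (N b w - N a w)%N = 0%N].
  by apply/seteqP; split=> w /=; rewrite ltnNge -subn_eq0 => /eqP.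
rewrite probability_setC// (poisson_increments hN)// /poisson_pmf.
rewrite ifT ?mulr_gt0 ?subr_gt0// expr0 fact0 invr1 !mul1r.
rewrite -EFinB lee_fin lerBlDr -lerBlDl.
exact: expR_ge1Dx.
Qed.

Lemma grid_cell (h t : R) : 0 < h -> 0 < t ->
  exists i : nat, i%:R * h < t <= i.+1%:R * h.
Proof.
move=> h0 t0.
have ex : exists n : nat, t <= n%:R * h.
  exists (Num.bound (t / h)).
  by rewrite -ler_pdivrMr// ltW// archi_boundP// divr_ge0 ?ltW.
case: (ex_minnP ex) => -[|i] ti imin; first by rewrite mul0r leNgt t0 in ti.
exists i; rewrite ti andbT ltNge; apply/negP => /imin; by rewrite ltnn.
Qed.

(** For each mesh h, the bad event lies in the union over i of the events that
    tau is in the cell ]i h, (i + 1) h] and that N grows over this cell.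
    By independence its probability is at most the sum over i of
    [P (tau in cell i) * (alpha * h)]; the cells being disjoint, this is at
    most [alpha * h]. Working with cells replaces an application of Fubini's
    theorem to the joint law of tau and N. *)
Lemma no_jump_at_independent_time alpha N tau :
  is_poisson_process alpha N -> 0 < alpha -> measurable_fun setT tau ->
  (forall (A : set R) a b, measurable A -> 0 <= a -> a < b ->
    P (tau @^-1` A `&` [set w | (N a w < N b w)%N]) =
    (P (tau @^-1` A) * P [set w | (N a w < N b w)%N])%E) ->
  {ae P, forall w,
    ~ (0 < tau w /\ forall r, 0 <= r < tau w -> (N r w < N (tau w) w)%N)}.
Proof.
move=> hN alpha0 mtau indep.
pose I (h : R) (i : nat) : set R := `]i%:R * h, i.+1%:R * h]%classic.
pose F h i := tau @^-1` I h i `&` [set w | (N (i%:R * h)%R w < N (i.+1%:R * h)%R w)%N].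
have mtauI h i : measurable (tau @^-1` I h i).
  by rewrite -[X in measurable X]setTI; apply: mtau => //; exact: measurable_itv.
have mF h i : measurable (F h i).
  apply: measurableI => //.
  by rewrite -[X in measurable X]setTI; apply: measurable_fun_ltn.
have Idisj h : 0 < h -> trivIset setT (fun i => tau @^-1` I h i).
  move=> h0; apply/trivIsetP => i j _ _.
  wlog ij : i j / (i < j)%N.
    move=> wl; rewrite neq_ltn => /orP[ij|ji].
      by apply: wl => //; rewrite ltn_eqF.
    by rewrite setIC; apply: wl => //; rewrite ltn_eqF.
  move=> _; rewrite -subset0 => w []; rewrite /I /= !in_itv /= => /andP[_ wi] /andP[jw _].
  have : i.+1%:R * h <= j%:R * h by rewrite ler_pM2r// ler_nat.
  by move=> /(le_trans wi); rewrite leNgt jw.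
have PF h : 0 < h -> (P (\bigcup_i F h i) <= (alpha * h)%:E)%E.
  move=> h0.
  have trF : trivIset setT (F h).
    by apply: trivIset_setIr; exact: Idisj.
  rewrite measure_bigcup//.
  apply: (@le_trans _ _ (\sum_(0 <= i <oo | i \in setT) ((alpha * h)%:E * P (tau @^-1` I h i)))%E).
    apply: lee_nneseries => [i _ _|i _]; first exact: measure_ge0.
    have ih : i%:R * h < i.+1%:R * h by rewrite ltr_pM2r// ltr_nat.
    have ih0 : 0 <= i%:R * h by rewrite mulr_ge0// ltW.
    rewrite [leLHS](_ : _ = (P (tau @^-1` I h i) *
        P [set w | (N (i%:R * h)%R w < N (i.+1%:R * h)%R w)%N])%E); last first.
      by apply: indep => //; exact: measurable_itv.
    rewrite muleC lee_wpmul2r//.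
    apply: (le_trans (poisson_jump_prob hN alpha0 ih0 ih)).
    by rewrite -mulrBl -natrB// subSnn mul1r.
  rewrite nneseriesZl; last by move=> i _; exact: measure_ge0.
  rewrite -measure_bigcup//; last exact: Idisj.
  rewrite -[leRHS]mule1 lee_wpmul2l ?lee_fin ?mulr_ge0 ?(ltW alpha0) ?(ltW h0)//.
  by apply: probability_le1; exact: bigcup_measurable.
(* The meshes 1 / (m + 1) suffice, and make the exceptional event measurable. *)
pose Z := \bigcap_m \bigcup_i F m.+1%:R^-1 i.
have mZ : measurable Z by apply: bigcap_measurable => [|m _]; [by exists 0%N|exact: bigcup_measurable].
have Z0 : P Z = 0.
  apply/eqP; rewrite eq_le measure_ge0 andbT; apply/lee_addgt0Pr => e e0.
  rewrite add0e.
  have /near_invn_lt[m _ me] : 0 < e / alpha by rewrite divr_gt0.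
  have {me} := me m.+1 (leqnSn m) => me.
  apply: (@le_trans _ _ (P (\bigcup_i F m.+1%:R^-1 i))).
    apply: le_measure; rewrite ?inE//; first exact: bigcup_measurable.
    exact: bigcap_inf.
  apply: (le_trans (PF _ _)); first by rewrite invr_gt0.
  by rewrite lee_fin mulrC -ler_pdivlMr// ltW.
have nZ : {ae P, forall w, ~ Z w}.
  by exists Z; split=> // w /=; apply: contrapT.
apply: filterS2 nZ (poisson_paths hN) => w nZw [mono _] [tau0 jmp].
apply: nZw => m _.
have h0 : 0 < m.+1%:R^-1 :> R by rewrite invr_gt0.
have [i ti] := grid_cell h0 tau0; exists i => //; split=> /=.
  by rewrite /I /= in_itv.
move: ti => /andP[it ti]; have i0 : 0 <= i%:R * m.+1%:R^-1 :> R by [].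
apply: (leq_trans (jmp _ _)); first by rewrite i0.
by apply: mono => //; exact: ltW.
Qed.

End NoCommonJump.

(** * Claims at a given level *)

Section ClaimTimes.
Context d (T : measurableType d) (R : realType) (P : probability T R).
Context (alpha c : R) (N : R -> {RV P >-> nat}) (Y : nat -> {RV P >-> R}).

Lemma claim_level_independent (y : R) (j : nat) (A : set R) (a b : R) :
  independent_processes P [set t : R | 0 <= t] [set: nat] N Y ->
  measurable A -> 0 <= a -> a < b ->
  let tau w := (y + \sum_(i < j) Y i w) / c in
  P (tau @^-1` A `&` [set w | (N a w < N b w)%N]) =
  (P (tau @^-1` A) * P [set w | (N a w < N b w)%N])%E.
Proof.
move=> hNY mA a0 ab tau; rewrite setIC muleC; apply: hNY.
- rewrite /process_sigma_algebra.
  set G := \bigcup_(i in _) _.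
  have mN s : 0 <= s -> measurable_fun (setT : set (g_sigma_algebraType G)) (N s).
    by move=> s0; exact: process_measurable.
  have := measurable_fun_ltn (mN a a0) (mN b (le_trans a0 (ltW ab))).
  by move=> /(_ measurableT [set true] I); rewrite setTI.
- rewrite /process_sigma_algebra.
  set G := \bigcup_(i in _) _.
  have mtau : measurable_fun (setT : set (g_sigma_algebraType G)) tau.
    apply: measurable_funM => //; apply: measurable_funD => //.
    by apply: measurable_sum => i; exact: process_measurable.
  by have := mtau measurableT A mA; rewrite setTI.
Qed.

(** With [y = x - x0], [tau] is the only time at which the risk process can be at
    the level x with exactly j claims deducted. *)
Lemma no_claim_at_level (y : R) (j : nat) :
  is_poisson_process alpha N -> 0 < alpha ->
  independent_processes P [set t : R | 0 <= t] [set: nat] N Y ->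
  {ae P, forall w, let tau := (y + \sum_(i < j) Y i w) / c in
    ~ (0 < tau /\ forall r, 0 <= r < tau -> (N r w < N tau w)%N)}.
Proof.
move=> hN alpha0 hNY.
apply: (@no_jump_at_independent_time _ _ _ _ alpha _
  (fun w => (y + \sum_(i < j) Y i w) / c)) => //.
  apply: measurable_funM => //; apply: measurable_funD => //.
  exact: measurable_sum.
by move=> A a b; exact: claim_level_independent.
Qed.

End ClaimTimes.

Theorem proposition2 (R : realType) (d : measure_display)
    (T : measurableType d) (P : probability T R)
    (x0 c alpha : R) (N : R -> {RV P >-> nat}) (Y : nat -> {RV P >-> R})
    (hx0 : 0 <= x0) (hc : 0 < c) (halpha : 0 < alpha)
    (hN : is_poisson_process alpha N)
    (hY : iid Y)
    (hY_ge0 : forall k : nat, {ae P, forall w : T, 0 <= Y k w})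
    (hNY : independent_processes P [set t : R | 0 <= t] [set: nat] N Y)
    (hY_mean : P.-integrable [set: T] (EFin \o Y 0%N))
    (hY_density : has_density (Y 0%N))
    (x : R) :
  let X := fun (w : T) (t : R) => risk_process x0 c N Y t w in
  {ae P, forall w : T, forall n : nat, (0 < n)%N -> forall t : R, 0 < t ->
    approx_local_field c x n (X w) t =
      \int[lebesgue_measure]_(s in `]0, t]) dphi x n (left_lim (X w) s)
      + c^-1 * \sum_(s \in `]0, t]) (dphi x n (left_lim (X w) s) * jump (X w) s)}
  /\
  {ae P, forall w : T, forall t : R, 0 < t ->
    approx_local_field c x n (X w) t @[n --> \oo] --> local_field c x0 x (X w) t}.
Proof.
move=> X; split.
  apply: filterS (poisson_paths hN) => w [mono rcont] n n0 t t0.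
  apply: approx_local_fieldE => //; last exact: ltW.
  exact: (@risk_path_affine_pieces _ x0 c (fun t => N t w) (fun j => \sum_(i < j) Y i w)).
have /ae_foralln noclaim j := no_claim_at_level c (x - x0) j hN halpha hNY.
apply: filterS3 noclaim (poisson_start hN) (poisson_paths hN) => w ncw N0 [mono rcont] t t0.
have X0 : X w 0 = x0 by rewrite /X /risk_process N0 big_ord0 mulr0 addr0 subr0.
have pieces := @risk_path_affine_pieces _ x0 c (fun t => N t w)
  (fun j => \sum_(i < j) Y i w) mono rcont.
(* Applied to the number of claims before s for the left limit, and to the
   number of claims up to s for the value at s. *)
have claim_neq s j : 0 < s -> (forall r, 0 <= r < s -> (N r w < N s w)%N) ->
    x0 + c * s - \sum_(i < j) Y i w != x.
  move=> s0 jmp; apply/negP => /eqP xE; apply: (ncw j) => /=.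
  suff -> : (x - x0 + \sum_(i < j) Y i w) / c = s by [].
  by rewrite -xE; field; rewrite gt_eqF.
rewrite -X0; apply: approx_local_field_cvg => //; first exact: ltW.
move=> s s0 Xs.
have [jmp [j Xsl]] := @risk_path_jump _ x0 c (fun t => N t w)
  (fun j => \sum_(i < j) Y i w) mono s s0 Xs.
split; last exact: claim_neq.
by rewrite Xsl; exact: claim_neq.
Qed.
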